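(* Let $(U,\mu)$ be a fuzzy Hilbert space (satisfying the standing assumptions in the context), let $K_1,K_2$ be strongly fuzzy bounded linear operators on $U$, and let $\{f_i\}_{i=1}^\infty$ be both a fuzzy $K_1$-frame and a fuzzy $K_2$-frame for $U$. Then for any scalars $a,b$, $\{f_i\}_{i=1}^\infty$ is a fuzzy $(aK_1+bK_2)$-frame for $U$ and a fuzzy $K_1K_2$-frame for $U$.
   Context: Let $U$ be a complex vector space with zero vector $\theta$. A fuzzy inner product on $U$ is a map $\mu:U\times U\times\mathbb C\to[0,1]$ such that for all $x,y,z\in U$, $s,t\in\mathbb C$: (FIP1) $\mu(x+y,z,|t|+|s|)\ge\min\{\mu(x,z,|t|),\mu(y,z,|s|)\}$; (FIP2) $\mu(x,y,|st|)\ge\min\{\mu(x,x,|s|^2),\mu(y,y,|t|^2)\}$; (FIP3) $\mu(x,y,t)=\mu(y,x,\overline t)$; (FIP4) $\mu(cx,y,t)=\mu(x,y,t/|c|)$ for $c\in\mathbb C\setminus\{0\}$; (FIP5) $\mu(x,x,t)=0$ for $t\in\mathbb C\setminus\mathbb R^+$; (FIP6) $\mu(x,x,t)=1$ for all $t>0$ iff $x=\theta$; (FIP7) $\mu(x,x,\cdot):\mathbb R\to[0,1]$ is non-decreasing with limit $1$ at $+\infty$. Put $N(x,t)=\mu(x,x,t^2)$ for $t>0$ and $N(x,t)=0$ for real $t\le0$. Standing assumptions: (FIP8) if $\mu(x,x,t^2)>0$ for all $t>0$ then $x=\theta$; (FIP9) the norms $\|x\|_\alpha=\inf\{t>0:N(x,t)\ge\alpha\}$,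 $\alpha\in(0,1)$ (the $\alpha$-norms, an ascending family of norms on $U$), satisfy the parallelogram law. Let $\langle\cdot,\cdot\rangle_\alpha$ be the inner product obtained from $\|\cdot\|_\alpha$ by polarization. $(U,\mu)$ is a fuzzy Hilbert space if $U$ is complete with respect to $\|\cdot\|_\alpha$ for every $\alpha\in(0,1)$. A linear operator $T$ on $U$ is strongly fuzzy bounded if there is $M>0$ with $N(Tx,s)\ge N(x,s/M)$ for all $x\in U,s\in\mathbb R$ (equivalently $\|Tx\|_\alpha\le M\|x\|_\alpha$ for all $x$ and all $\alpha\in(0,1)$, for some $M>0$). Every strongly fuzzy bounded linear operator $T$ on $U$ under consideration is taken to possess an adjoint $T^*$: a strongly fuzzy bounded linear operator on $U$ with $\langle x,Ty\rangle_\alpha=\langle T^*x,y\rangle_\alpha$ for all $x,y\in U$ and all $\alpha\in(0,1)$. For a strongly fuzzy bounded linear operator $K$ on $U$, a sequence $\{f_i\}_{i=1}^\infty$ in $U$ is a fuzzy $K$-frame for $U$ if there are constants $0<A\le B<\infty$ with $A\|K^*f\|_\alpha^2\le\sum_{i=1}^\infty|\langle f,f_i\rangle_\alpha|^2\le B\|f\|_\alpha^2$ for all $f\in U$ and all $\alpha\in(0,1)$. *)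

(* Defs.v *)
From HB Require Import structures.
From mathcomp Require Import all_boot all_order all_algebra.
From mathcomp Require Export complex.
From mathcomp Require Import all_classical all_reals all_analysis.

Set Implicit Arguments.
Unset Strict Implicit.
Unset Printing Implicit Defensive.

Import Order.TTheory GRing.Theory Num.Theory numFieldNormedType.Exports.
Local Open Scope classical_set_scope.
Local Open Scope complex_scope.
Local Open Scope ring_scope.

(* On [R[i]], [`|z|] is the modulus as a nonnegative real element of [R[i]],
   [normc z : R] is the same number in [R], and [0 < z] means that [z] is a
   positive real. *)

(* [R^+] in (FIP5) is read as the set of (strictly) positive reals. *)
Record fuzzy_inner_product (R : realType) (U : lmodType R[i])
    (mu : U -> U -> R[i] -> R) : Prop := FuzzyInnerProduct {
  fip_range : forall (x y : U) (t : R[i]), 0 <= mu x y t <= 1;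
  fip1 : forall (x y z : U) (s t : R[i]),
    Num.min (mu x z `|t|) (mu y z `|s|) <= mu (x + y) z (`|t| + `|s|);
  fip2 : forall (x y : U) (s t : R[i]),
    Num.min (mu x x (`|s| ^+ 2)) (mu y y (`|t| ^+ 2)) <= mu x y `|s * t|;
  fip3 : forall (x y : U) (t : R[i]), mu x y t = mu y x (t^*);
  fip4 : forall (x y : U) (c t : R[i]), c != 0 ->
    mu (c *: x) y t = mu x y (t / `|c|);
  fip5 : forall (x : U) (t : R[i]), ~~ (0 < t) -> mu x x t = 0;
  fip6 : forall x : U, (forall t : R, 0 < t -> mu x x t%:C = 1) <-> x = 0;
  fip7_mono : forall (x : U) (s t : R), s <= t -> mu x x s%:C <= mu x x t%:C;
  fip7_lim : forall x : U, mu x x t%:C @[t --> +oo] --> (1 : R)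
}.

Definition fuzzy_norm (R : realType) (U : lmodType R[i])
    (mu : U -> U -> R[i] -> R) (x : U) (t : R) : R :=
  if 0 < t then mu x x (t ^+ 2)%:C else 0.

Definition alpha_norm (R : realType) (U : lmodType R[i])
    (mu : U -> U -> R[i] -> R) (alpha : R) (x : U) : R :=
  inf [set t : R | 0 < t /\ alpha <= fuzzy_norm mu x t].

(* Polarization, linear in the first argument. *)
Definition alpha_inner (R : realType) (U : lmodType R[i])
    (mu : U -> U -> R[i] -> R) (alpha : R) (x y : U) : R[i] :=
  let sqn (u : U) : R[i] := (alpha_norm mu alpha u ^+ 2)%:C in
  4%:R^-1 * (sqn (x + y) - sqn (x - y)
             + 'i%C * sqn (x + 'i%C *: y) - 'i%C * sqn (x - 'i%C *: y)).

Definition fip8 (R : realType) (U : lmodType R[i])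
    (mu : U -> U -> R[i] -> R) : Prop :=
  forall x : U, (forall t : R, 0 < t -> 0 < mu x x (t ^+ 2)%:C) -> x = 0.

Definition fip9 (R : realType) (U : lmodType R[i])
    (mu : U -> U -> R[i] -> R) : Prop :=
  forall alpha : R, 0 < alpha < 1 -> forall x y : U,
    alpha_norm mu alpha (x + y) ^+ 2 + alpha_norm mu alpha (x - y) ^+ 2 =
    2 * alpha_norm mu alpha x ^+ 2 + 2 * alpha_norm mu alpha y ^+ 2.

Definition alpha_complete (R : realType) (U : lmodType R[i])
    (mu : U -> U -> R[i] -> R) (alpha : R) : Prop :=
  forall u : nat -> U,
    (forall e : R, 0 < e -> exists n0 : nat, forall m n : nat,
      (n0 <= m)%N -> (n0 <= n)%N -> alpha_norm mu alpha (u m - u n) < e) ->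
    exists l : U, alpha_norm mu alpha (u n - l) @[n --> \oo] --> (0 : R).

Record fuzzy_hilbert_space (R : realType) (U : lmodType R[i])
    (mu : U -> U -> R[i] -> R) : Prop := FuzzyHilbertSpace {
  fhs_fip : fuzzy_inner_product mu;
  fhs_fip8 : fip8 mu;
  fhs_fip9 : fip9 mu;
  fhs_complete : forall alpha : R, 0 < alpha < 1 -> alpha_complete mu alpha
}.

Definition strongly_fuzzy_bounded (R : realType) (U : lmodType R[i])
    (mu : U -> U -> R[i] -> R) (T : {linear U -> U}) : Prop :=
  exists M : R, 0 < M /\
    forall (x : U) (s : R), fuzzy_norm mu x (s / M) <= fuzzy_norm mu (T x) s.

Definition fuzzy_adjoint (R : realType) (U : lmodType R[i])
    (mu : U -> U -> R[i] -> R) (T Tstar : {linear U -> U}) : Prop :=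
  strongly_fuzzy_bounded mu Tstar /\
  forall alpha : R, 0 < alpha < 1 -> forall x y : U,
    alpha_inner mu alpha x (T y) = alpha_inner mu alpha (Tstar x) y.

(* An adjoint is unique, since the alpha-norms are definite, so quantifying
   it existentially just names [K^*].  The constants [A] and [B] do not depend
   on [alpha].  The sequence is indexed from 0 instead of 1, and the series of
   nonnegative terms is taken in [\bar R], so that its convergence is part of
   the upper bound. *)
Definition fuzzy_K_frame (R : realType) (U : lmodType R[i])
    (mu : U -> U -> R[i] -> R) (K : {linear U -> U}) (f : nat -> U) : Prop :=
  strongly_fuzzy_bounded mu K /\
  exists Kstar : {linear U -> U}, fuzzy_adjoint mu K Kstar /\
  exists A B : R, [/\ 0 < A, A <= B &
    forall (g : U) (alpha : R), 0 < alpha < 1 ->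
      let S := (\sum_(0 <= i <oo)
                  (Normc.normc (alpha_inner mu alpha g (f i)) ^+ 2)%:E)%E in
      ((A * alpha_norm mu alpha (Kstar g) ^+ 2)%:E <= S)%E /\
      (S <= (B * alpha_norm mu alpha g ^+ 2)%:E)%E].

(* Main.v *)
Require Import Defs.
From HB Require Import structures.
From mathcomp Require Import all_boot all_order all_algebra.
From mathcomp Require Import complex.
From mathcomp Require Import all_classical all_reals all_analysis.
From mathcomp Require Import ring lra.

Set Implicit Arguments.
Unset Strict Implicit.
Unset Printing Implicit Defensive.

Import Order.TTheory GRing.Theory Num.Theory numFieldNormedType.Exports.
Local Open Scope ring_scope.

(** The only delicate point is the adjoint of a K1 + b K2: its formula
    conj(a) K1^* + conj(b) K2^* requires each alpha-inner product to be
    sesquilinear.  It is only defined by polarization, so this is the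
    Jordan-von Neumann theorem for the parallelogram law (FIP9).  The lower frame
    bound for a K1 + b K2 then follows from |u+v|^2 <= 2|u|^2 + 2|v|^2, and the
    one for K1 K2 from the boundedness of K2^* in (K1 K2)^* = K2^* K1^*; the upper
    bound does not involve the operator. *)

(* [r *+ n] differs from an integer by an element of [0, 1], so [n |g r| <= C]
   for all [n]. *)
Lemma additive_bounded_eq0 (R : realType) (g : R -> R) (C : R) :
  (forall r s, g (r + s) = g r + g s) -> g 1 = 0 ->
  (forall u, 0 <= u <= 1 -> `|g u| <= C) -> forall r, g r = 0.
Proof.
move=> gD g1 gC r.
have g0 : g 0 = 0 by have := gD 0 0; rewrite addr0; lra.
have gN s : g (- s) = - g s by have := gD s (- s); rewrite subrr g0; lra.
have gMn s n : g (s *+ n) = g s *+ n.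
  by elim: n => [|n IH]; rewrite ?mulr0n // !mulrS gD IH.
have gZ (m : int) : g m%:~R = 0.
  case: m => n; first by rewrite -pmulrn gMn g1 mul0rn.
  by rewrite NegzE mulrNz gN -pmulrn gMn g1 mul0rn oppr0.
have gb s : `|g s| <= C.
  rewrite -[s](subrK (Num.floor s)%:~R) gD gZ addr0; apply: gC.
  have /andP[] := floor_itv s; rewrite intrD; lra.
apply/eqP/negPn/negP; rewrite -normr_gt0 => gr0.
have := gb (r *+ (Num.truncn (C / `|g r|)).+1).
rewrite gMn normrMn leNgt -mulr_natr mulrC -ltr_pdivrMr //.
by rewrite truncnS_gt.
Qed.

Lemma normc_gt0 (R : realType) (c : R[i]) : c != 0 -> 0 < Normc.normc c.
Proof. by rewrite -normr_gt0 -ltcR. Qed.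

(** * Jordan-von Neumann: a squared norm with the parallelogram law polarizes to a sesquilinear
    form *)

Section Polarization.
Variables (R : realType) (U : lmodType R[i]) (q : U -> R).
Hypothesis q_ge0 : forall x, 0 <= q x.
Hypothesis qZ : forall c x, q (c *: x) = Normc.normc c ^+ 2 * q x.
Hypothesis q_par : forall x y, q (x + y) + q (x - y) = 2 * q x + 2 * q y.

Let qN x : q (- x) = q x.
Proof. by rewrite -scaleN1r qZ /= !(oppr0, expr0n, sqrrN, expr1n, addr0) sqrtr1 expr1n mul1r. Qed.

Let qi x : q ('i%C *: x) = q x.
Proof. by rewrite qZ /= expr0n expr1n add0r sqrtr1 expr1n mul1r. Qed.

Definition polar (x y : U) : R := q (x + y) - q (x - y).

Let qB x y : q (x - y) = q (y - x).
Proof. by rewrite -qN opprB. Qed.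

Lemma polarC x y : polar x y = polar y x.
Proof. by rewrite /polar (addrC x) qB. Qed.

Lemma polar0l y : polar 0 y = 0.
Proof. by rewrite /polar add0r sub0r qN subrr. Qed.

(** Subtract the parallelogram laws for the pairs [x + y], [z + y] and [x - y], [z - y]: both
    differences equal [x - z], so those terms cancel. *)
Lemma polar_half x z y : polar x y + polar z y = 2^-1 * polar (x + z) (y + y).
Proof.
have h1 := q_par (x + y) (z + y); have h2 := q_par (x - y) (z - y).
rewrite (addrACA x y z y) (_ : x + y - (z + y) = x - z) in h1; last first.
  by rewrite opprD addrACA subrr addr0.
rewrite (addrACA x (- y) z (- y)) -(opprD y y) in h2.
rewrite (_ : x - y - (z - y) = x - z) in h2; last first.
  by rewrite opprB addrA subrK.
rewrite /polar; lra.
Qed.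

Lemma polarDl x z y : polar (x + z) y = polar x y + polar z y.
Proof.
(* Replacing the pair [x], [z] by [x + z], [0] in [polar_half] leaves its right-hand side
   unchanged. *)
rewrite polar_half; have := polar_half (x + z) 0 y.
by rewrite polar0l !addr0.
Qed.

(* By additivity [s |-> polar (s x) y - s (polar x y)] vanishes at [1], and
   the parallelogram law bounds it on [0, 1]. *)
Lemma polarZl (r : R) x y : polar (r%:C%C *: x) y = r * polar x y.
Proof.
pose g s := polar (s%:C%C *: x) y - s * polar x y.
apply/eqP; rewrite -subr_eq0; apply/eqP; rewrite -/(g r).
apply: (@additive_bounded_eq0 _ g (2 * q x + 2 * q y + `|polar x y|)).
- by move=> s t; rewrite /g rmorphD /= scalerDl polarDl; ring.
- by rewrite /g scale1r mul1r subrr.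
move=> u /andP[u0 u1]; rewrite /g.
apply: (le_trans (ler_normB _ _)); apply: lerD; last first.
  by rewrite normrM ger0_norm // ler_piMl.
have h := q_par (u%:C%C *: x) y.
apply: (@le_trans _ _ (2 * q (u%:C%C *: x) + 2 * q y)).
  rewrite -h /polar; apply: (le_trans (ler_normB _ _)).
  by rewrite !ger0_norm.
rewrite lerD2r ler_pM2l // qZ ler_piMl //.
by rewrite /= expr0n addr0 sqrtr_sqr ger0_norm // expr_le1.
Qed.

Lemma polarii x y : polar ('i%C *: x) ('i%C *: y) = polar x y.
Proof. by rewrite /polar -scalerDr -scalerBr !qi. Qed.

(** Since [q] is invariant under multiplication by i, multiplying both arguments of [polar x (i y)]
    by i gives [polar (i x) (- y)]. *)
Lemma polar_il x y : polar ('i%C *: x) y = - polar x ('i%C *: y).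
Proof.
rewrite -(polarii x) scalerA -expr2 sqr_i scaleN1r /polar opprK opprB.
by rewrite addrC.
Qed.

(** This is the formula of [alpha_inner] for a general [q], grouped into real and imaginary parts so
    that each is a single real-valued [polar]. *)
Definition polar_inner (x y : U) : R[i] :=
  4%:R^-1 * ((polar x y)%:C%C + 'i%C * (polar x ('i%C *: y))%:C%C).

Lemma polar_innerDl x z y : polar_inner (x + z) y = polar_inner x y + polar_inner z y.
Proof. by rewrite /polar_inner !polarDl !rmorphD /=; ring. Qed.

(** Real scalars are handled by [polarZl], and i exchanges the two [polar] terms up to sign;
    additivity then gives [c = Re c + i Im c]. *)
Lemma polar_innerZl c x y : polar_inner (c *: x) y = c * polar_inner x y.
Proof.
have ci : 'i%C * 'i%C = -1 :> R[i] by rewrite -expr2 sqr_i.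
have hr (r : R) z w : polar_inner (r%:C%C *: z) w = r%:C%C * polar_inner z w.
  by rewrite /polar_inner !polarZl !rmorphM /=; ring.
have hi z w : polar_inner ('i%C *: z) w = 'i%C * polar_inner z w.
  rewrite /polar_inner polarii polar_il rmorphN /=.
  by rewrite [RHS]mulrCA; congr (_ * _); rewrite mulrDr mulrA ci mulN1r addrC.
rewrite [c]complexE scalerDl -scalerA polar_innerDl hi !hr.
by rewrite mulrDl mulrA.
Qed.

Lemma polar_innerC x y : polar_inner y x = conjc (polar_inner x y).
Proof.
rewrite /polar_inner (polarC y ('i%C *: x)) polar_il (polarC y x).
have ci : conjc 'i%C = - 'i%C :> R[i] by apply/eqP; rewrite eq_complex /= oppr0 !eqxx.
have cM (c d : R[i]) : conjc (c * d) = conjc c * conjc d by rewrite rmorphM.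
have cD (c d : R[i]) : conjc (c + d) = conjc c + conjc d by rewrite rmorphD.
rewrite cM cD cM !conjc_real ci.
by rewrite conjc_inv conjc_nat rmorphN mulrN mulNr.
Qed.

Lemma polar_innerDr x y z : polar_inner x (y + z) = polar_inner x y + polar_inner x z.
Proof. by rewrite ![polar_inner x _]polar_innerC polar_innerDl rmorphD. Qed.

Lemma polar_innerZr c x y : polar_inner x (c *: y) = conjc c * polar_inner x y.
Proof. by rewrite ![polar_inner x _]polar_innerC polar_innerZl rmorphM. Qed.

End Polarization.

(** * Fuzzy norm inequalities and strongly fuzzy bounded operators *)

Section FuzzyNorm.
Variables (R : realType) (U : lmodType R[i]) (mu : U -> U -> R[i] -> R).
Hypothesis hmu : fuzzy_inner_product mu.
Local Notation N := (fuzzy_norm mu).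
Local Notation "x %:C" := (real_complex R x) : ring_scope.

Let norm_real (r : R) : 0 <= r -> `|r%:C| = r%:C.
Proof. by move=> r0; rewrite ger0_norm // lecR. Qed.

Let fip1R x y z (s t : R) : 0 <= s -> 0 <= t ->
  Num.min (mu x z s%:C) (mu y z t%:C) <= mu (x + y) z (s + t)%:C.
Proof.
move=> s0 t0; have := fip1 hmu x y z t%:C s%:C.
by rewrite !norm_real // rmorphD.
Qed.

Let fip2R x y (s t : R) : 0 <= s -> 0 <= t ->
  Num.min (mu x x (s ^+ 2)%:C) (mu y y (t ^+ 2)%:C) <= mu x y (s * t)%:C.
Proof.
move=> s0 t0; have := fip2 hmu x y s%:C t%:C.
by rewrite -!rmorphM !norm_real ?mulr_ge0 // -!rmorphXn.
Qed.

Let fip3R x y (t : R) : mu x y t%:C = mu y x t%:C.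
Proof. by rewrite (fip3 hmu); congr (mu y x _); exact: conjc_real. Qed.

(* (FIP1) is applied along (s + t)^2 = (s^2 + s t) + (s t + t^2), and (FIP2)
   bounds the two cross terms. *)
Lemma fuzzy_normD x y (s t : R) : 0 < s -> 0 < t ->
  Num.min (N x s) (N y t) <= N (x + y) (s + t).
Proof.
move=> s0 t0; rewrite /fuzzy_norm s0 t0 addr_gt0 //.
have s0' := ltW s0; have t0' := ltW t0.
set m := Num.min _ _.
have mx : m <= mu x x (s ^+ 2)%:C by rewrite /m ge_min lexx.
have my : m <= mu y y (t ^+ 2)%:C by rewrite /m ge_min lexx orbT.
have mxy : m <= mu x y (s * t)%:C.
  by apply: le_trans (fip2R _ _ _ _); rewrite // le_min mx.
have -> : (s + t) ^+ 2 = (s ^+ 2 + s * t) + (s * t + t ^+ 2) by ring.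
apply: le_trans (fip1R _ _ _ _ _); rewrite ?addr_ge0 ?mulr_ge0 ?sqr_ge0 //.
rewrite le_min ![mu _ (x + y) _]fip3R; apply/andP; split.
  apply: le_trans (fip1R _ _ _ _ _); rewrite ?mulr_ge0 ?sqr_ge0 //.
  by rewrite le_min mx fip3R mxy.
apply: le_trans (fip1R _ _ _ _ _); rewrite ?mulr_ge0 ?sqr_ge0 //.
by rewrite le_min mxy my.
Qed.

(** (FIP4) is used once in each argument, by symmetry, so [s ^+ 2] is divided by the modulus of [c]
    twice. *)
Lemma fuzzy_normZ c x (s : R) : c != 0 ->
  N (c *: x) s = N x (s / Normc.normc c).
Proof.
move=> c0; set n := Normc.normc c.
have cE : `|c| = n%:C by [].
have n0 : 0 < n by exact: normc_gt0.
rewrite /fuzzy_norm pmulr_lgt0 ?invr_gt0 //; case: ifP => // _.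
have h y : mu (c *: x) y (s ^+ 2)%:C = mu x y (s ^+ 2 / n)%:C.
  by rewrite (fip4 hmu) // cE -fmorphV -rmorphM.
rewrite h fip3R (fip4 hmu) // cE -fmorphV -rmorphM.
by rewrite expr_div_n expr2 invfM mulrA.
Qed.

Lemma fuzzy_norm_mono x (s t : R) : s <= t -> N x s <= N x t.
Proof.
move=> st; rewrite /fuzzy_norm; case: ifPn => [s0|_]; last first.
  by case: ifP => // _; have /andP[] := fip_range hmu x x (t ^+ 2)%:C.
rewrite (lt_le_trans s0 st); apply: (fip7_mono hmu).
by rewrite lerXn2r // nnegrE ltW // (lt_le_trans s0 st).
Qed.

Lemma fuzzy_norm0 (s : R) : 0 < s -> N 0 s = 1.
Proof. by move=> s0; rewrite /fuzzy_norm s0; apply: (fip6 hmu 0).2 => //; rewrite exprn_gt0. Qed.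

Lemma strongly_fuzzy_boundedD (S T : {linear U -> U}) :
  strongly_fuzzy_bounded mu S -> strongly_fuzzy_bounded mu T ->
  strongly_fuzzy_bounded mu (S \+ T).
Proof.
move=> [M [M0 hS]] [L [L0 hT]]; exists (M + L); split; first exact: addr_gt0.
have ML0 : 0 < M + L by exact: addr_gt0.
move=> x s; have [s0|s0] := ltP 0 s; last first.
  by rewrite /fuzzy_norm pmulr_lgt0 ?invr_gt0 // ltNge s0.
(* Splitting [s] in the ratio M : L makes both pieces, divided by their own bounds, equal to
   [s / (M + L)]. *)
have -> : s = M * (s / (M + L)) + L * (s / (M + L)).
  by rewrite -mulrDl mulrCA divff ?mulr1 // gt_eqF.
set t := s / (M + L); rewrite -mulrDl mulrAC mulrV ?unitfE ?gt_eqF // mul1r.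
have t0 : 0 < t by rewrite divr_gt0.
rewrite [X in _ <= N X _]/=; rewrite mulrDl.
apply: le_trans (fuzzy_normD _ _ _ _); [rewrite le_min|exact: mulr_gt0|exact: mulr_gt0].
apply/andP; split.
  by have := hS x (M * t); rewrite mulrAC divff ?mul1r // gt_eqF.
by have := hT x (L * t); rewrite mulrAC divff ?mul1r // gt_eqF.
Qed.

Lemma strongly_fuzzy_boundedZ c (T : {linear U -> U}) :
  strongly_fuzzy_bounded mu T -> strongly_fuzzy_bounded mu (c \*: T).
Proof.
move=> [M [M0 hT]]; have n0 : 0 <= Normc.normc c by case: c => ? ?; exact: sqrtr_ge0.
(* The added 1 keeps [L] positive when [c = 0]; monotonicity of the fuzzy norm absorbs it
   otherwise. *)
pose L := (Normc.normc c + 1) * M.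
have L0 : 0 < L by rewrite mulr_gt0 // ltr_wpDl.
exists L; split=> // x s; rewrite [X in _ <= N X _]/=.
have [s0|s0] := ltP 0 s; last first.
  by rewrite /fuzzy_norm pmulr_lgt0 ?invr_gt0 // ltNge s0.
have [->|c0] := eqVneq c 0.
  rewrite scale0r fuzzy_norm0 // /fuzzy_norm divr_gt0 //.
  by have /andP[] := fip_range hmu x x ((s / L) ^+ 2)%:C.
rewrite fuzzy_normZ //; apply: le_trans (hT _ _); apply: fuzzy_norm_mono.
have n1 := normc_gt0 c0.
rewrite -mulrA -invfM ler_pM2l // lef_pV2 ?posrE ?mulr_gt0 //; last by rewrite ltr_wpDl.
by rewrite ler_pM2r // lerDl.
Qed.

Lemma strongly_fuzzy_bounded_comp (S T : {linear U -> U}) :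
  strongly_fuzzy_bounded mu S -> strongly_fuzzy_bounded mu T ->
  strongly_fuzzy_bounded mu (S \o T).
Proof.
move=> [M [M0 hS]] [L [L0 hT]]; exists (M * L); split; first exact: mulr_gt0.
move=> x s; apply: le_trans (hS _ _); apply: le_trans (hT _ _).
by rewrite invfM mulrA.
Qed.

(** * Homogeneity and comparison of the alpha-norms *)

Section AlphaNorm.
Variable alpha : R.
Hypothesis alpha01 : 0 < alpha < 1.
Local Notation an := (alpha_norm mu alpha).

Let level_nonempty x : exists t, 0 < t /\ alpha <= N x t.
Proof.
have /andP[_ a1] := alpha01.
have /cvgrPdist_lt/(_ (1 - alpha)) := fip7_lim hmu x.
rewrite subr_gt0 => /(_ a1) [B [_ hB]].
(* As [t >= 1], one has [B < t <= t ^+ 2], and [fuzzy_norm] evaluates [mu] at the square. *)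
pose t := `|B| + 1.
have t1 : 1 <= t by rewrite lerDr.
have t0 : 0 < t := lt_le_trans ltr01 t1.
exists t; split=> //; rewrite /fuzzy_norm t0.
have /hB : B < t ^+ 2.
  apply: (@lt_le_trans _ _ t); last by rewrite expr2 ler_peMl // ltW.
  by rewrite (le_lt_trans (ler_norm B)) // ltrDl.
by rewrite ltr_norml => /andP[_]; rewrite ltrD2l ltrN2 => /ltW.
Qed.

Lemma alpha_norm_ge0 x : 0 <= an x.
Proof.
by apply: lb_le_inf; [exact: level_nonempty|move=> t [/ltW]].
Qed.

(** If [t] is admissible in the infimum for [x], then [M * t] is admissible in the one for [y]. Two
    unrelated vectors are allowed so that this serves both operators and scalar multiples. *)
Lemma alpha_norm_le x y (M : R) : 0 < M ->
  (forall s, N x (s / M) <= N y s) -> an y <= M * an x.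
Proof.
move=> M0 h; rewrite mulrC -ler_pdivrMr //.
apply: lb_le_inf; first exact: level_nonempty.
move=> t [t0 ht]; rewrite ler_pdivrMr //; apply: ge_inf.
  by exists 0 => u [/ltW].
split; first exact: mulr_gt0.
by apply: le_trans (h _); rewrite mulfK ?gt_eqF.
Qed.

Lemma alpha_normZ c x : an (c *: x) = Normc.normc c * an x.
Proof.
have [->|c0] := eqVneq c 0.
  rewrite scale0r Normc.normc0 mul0r; apply/eqP; rewrite eq_le alpha_norm_ge0 andbT.
  (* The fuzzy norm of 0 is constant on positive reals, so rescaling by one half costs nothing; this
     forces the nonnegative [an 0] to vanish. *)
  have : an 0 <= 2^-1 * an 0.
    apply: alpha_norm_le => // s; have [s0|s0] := ltP 0 s; first by rewrite !fuzzy_norm0 // divr_gt0.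
    by rewrite /fuzzy_norm invrK pmulr_lgt0 // ltNge s0.
  lra.
have le d y : d != 0 -> an (d *: y) <= Normc.normc d * an y.
  by move=> d0; apply: alpha_norm_le => [|s]; [exact: normc_gt0|rewrite fuzzy_normZ].
(* The reverse inequality is [le] for the scalar [c^-1] and the vector [c *: x]. *)
apply/eqP; rewrite eq_le le //= mulrC -ler_pdivlMr ?normc_gt0 // mulrC -Normc.normcV.
by rewrite -{1}[x](scalerK c0) le // invr_eq0.
Qed.

Lemma alpha_inner_polar x y :
  alpha_inner mu alpha x y = polar_inner (fun u => an u ^+ 2) x y.
Proof. by rewrite /alpha_inner /polar_inner /polar !rmorphB /=; ring. Qed.

End AlphaNorm.
End FuzzyNorm.

(** * Adjoints of combined operators and a working form of the frame bounds *)

Section FuzzyHilbert.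
Variables (R : realType) (U : lmodType R[i]) (mu : U -> U -> R[i] -> R).
Hypothesis hU : fuzzy_hilbert_space mu.
Let hmu := fhs_fip hU.

Lemma sqr_alpha_normD_le alpha x y : 0 < alpha < 1 ->
  alpha_norm mu alpha (x + y) ^+ 2 <=
    2 * alpha_norm mu alpha x ^+ 2 + 2 * alpha_norm mu alpha y ^+ 2.
Proof.
by move=> a01; rewrite -(fhs_fip9 hU a01) lerDl sqr_ge0.
Qed.

Let qZ alpha : 0 < alpha < 1 -> forall c x,
  alpha_norm mu alpha (c *: x) ^+ 2 =
    Normc.normc c ^+ 2 * alpha_norm mu alpha x ^+ 2.
Proof. by move=> a01 c x; rewrite (alpha_normZ hmu a01) exprMn. Qed.

Lemma fuzzy_adjoint_comp S T S' T' :
  fuzzy_adjoint mu S S' -> fuzzy_adjoint mu T T' ->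
  fuzzy_adjoint mu (S \o T) (T' \o S').
Proof.
move=> [bS hS] [bT hT]; split; first exact: strongly_fuzzy_bounded_comp.
by move=> alpha a01 x y; rewrite /= hS // hT.
Qed.

Lemma fuzzy_adjoint_lincomb a b S T S' T' :
  fuzzy_adjoint mu S S' -> fuzzy_adjoint mu T T' ->
  fuzzy_adjoint mu (a \*: S \+ b \*: T) (conjc a \*: S' \+ conjc b \*: T').
Proof.
move=> [bS hS] [bT hT]; split; first by apply: (strongly_fuzzy_boundedD hmu); exact: (strongly_fuzzy_boundedZ hmu).
move=> alpha a01 x y; have := hS _ a01 x y; have := hT _ a01 x y.
have q0 u : 0 <= alpha_norm mu alpha u ^+ 2 by exact: sqr_ge0.
have hZ := qZ a01; have hP := fhs_fip9 hU a01.
rewrite !alpha_inner_polar /=.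
rewrite (polar_innerDr hZ hP) !(polar_innerZr q0 hZ hP) => -> ->.
by rewrite (polar_innerDl hZ hP) !(polar_innerZl q0 hZ hP).
Qed.

(** Here the series is a real number [s] and [C] plays the role of the inverse of the lower frame
    constant, so lower bounds combine by sums and products. *)
Lemma fuzzy_K_frame_of_bounds (f : nat -> U) K K' (B C : R) :
  strongly_fuzzy_bounded mu K -> fuzzy_adjoint mu K K' -> 0 < B -> 0 < C ->
  (forall g alpha, 0 < alpha < 1 -> exists s : R,
    [/\ (\sum_(0 <= i <oo)
           (Normc.normc (alpha_inner mu alpha g (f i)) ^+ 2)%:E)%E = s%:E,
      s <= B * alpha_norm mu alpha g ^+ 2 &
      alpha_norm mu alpha (K' g) ^+ 2 <= C * s]) ->
  fuzzy_K_frame mu K f.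
Proof.
move=> bK aK B0 C0 h; split=> //; exists K'; split=> //.
(* The minimum with [B] secures the required order of the two constants. *)
exists (Num.min C^-1 B), B; split.
- by rewrite lt_min invr_gt0 C0.
- by rewrite ge_min lexx orbT.
move=> g alpha a01 /=; have [s [-> sB sC]] := h g _ a01; rewrite !lee_fin; split=> //.
apply: (@le_trans _ _ (C^-1 * alpha_norm mu alpha (K' g) ^+ 2)).
  by rewrite ler_wpM2r ?sqr_ge0 // ge_min lexx.
by rewrite mulrC ler_pdivrMr // mulrC.
Qed.

Lemma fuzzy_K_frame_bounds K (f : nat -> U) : fuzzy_K_frame mu K f ->
  exists K' (B C : R), [/\ fuzzy_adjoint mu K K', 0 < B, 0 < C &
    forall g alpha, 0 < alpha < 1 -> exists s : R,
    [/\ (\sum_(0 <= i <oo)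
           (Normc.normc (alpha_inner mu alpha g (f i)) ^+ 2)%:E)%E = s%:E,
      s <= B * alpha_norm mu alpha g ^+ 2 &
      alpha_norm mu alpha (K' g) ^+ 2 <= C * s]].
Proof.
move=> [_ [K' [aK [A [B [A0 AB h]]]]]]; exists K', B, A^-1.
split=> //; [exact: lt_le_trans AB|by rewrite invr_gt0|].
(* The series lies between two real numbers, which excludes both infinite values. *)
move=> g alpha a01; have /= [] := h g _ a01; case: (\sum_(_ <= _ <oo) _)%E => // s.
rewrite !lee_fin => As sB; exists s; split=> //.
by rewrite mulrC ler_pdivlMr // mulrC.
Qed.

End FuzzyHilbert.

Theorem theorem3p14 (R : realType) (U : lmodType R[i])
    (mu : U -> U -> R[i] -> R) (hU : fuzzy_hilbert_space mu)
    (K1 K2 : {linear U -> U})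
    (hK1 : strongly_fuzzy_bounded mu K1) (hK2 : strongly_fuzzy_bounded mu K2)
    (f : nat -> U)
    (hf1 : fuzzy_K_frame mu K1 f) (hf2 : fuzzy_K_frame mu K2 f)
    (a b : R[i]) :
  fuzzy_K_frame mu (a \*: K1 \+ b \*: K2) f /\
  fuzzy_K_frame mu (K1 \o K2) f.
Proof.
have hmu := fhs_fip hU.
have [L1 [B1 [C1 [a1 B10 C10 h1]]]] := fuzzy_K_frame_bounds hf1.
have [L2 [B2 [C2 [a2 B20 C20 h2]]]] := fuzzy_K_frame_bounds hf2.
split.
  pose na := Normc.normc (conjc a) ^+ 2; pose nb := Normc.normc (conjc b) ^+ 2.
  have na0 : 0 <= na by exact: sqr_ge0.
  have nb0 : 0 <= nb by exact: sqr_ge0.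
  (* The factors 2 come from the bound on the squared norm of a sum; the final 1 keeps the constant
     positive even when [a = b = 0]. *)
  apply: (fuzzy_K_frame_of_bounds (B := B1) (C := 2 * na * C1 + 2 * nb * C2 + 1)
    _ (fuzzy_adjoint_lincomb hU a b a1 a2)) => //.
  - by apply: (strongly_fuzzy_boundedD hmu); exact: (strongly_fuzzy_boundedZ hmu).
  - have := mulr_ge0 na0 (ltW C10); have := mulr_ge0 nb0 (ltW C20); lra.
  move=> g alpha a01.
  have [s [Ss sB sC1]] := h1 g _ a01; have [s' [Ss' _ sC2]] := h2 g _ a01.
  (* Both frame hypotheses concern the same series. *)
  have ss' : s' = s by move: Ss'; rewrite Ss => -[].
  subst s'; exists s; split=> //.
  (* Nonnegativity of [s] is what lets the extra 1 in the constant be absorbed. *)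
  have s0 : 0 <= s.
    by rewrite -(pmulr_rge0 _ C10); apply: le_trans sC1; exact: sqr_ge0.
  apply: (le_trans (sqr_alpha_normD_le hU _ _ a01)).
  rewrite !(alpha_normZ hmu a01) !exprMn -/na -/nb.
  have := ler_wpM2l na0 sC1; have := ler_wpM2l nb0 sC2; lra.
(* [M] bounds the adjoint [L2] of [K2]; it enters squared because [L2] is applied to [L1 g] inside a
   squared norm. *)
have [M [M0 hM]] := (proj1 a2).
apply: (fuzzy_K_frame_of_bounds (B := B1) (C := M ^+ 2 * C1) _
  (fuzzy_adjoint_comp a1 a2)) => //.
- exact: strongly_fuzzy_bounded_comp.
- by rewrite mulr_gt0 ?exprn_gt0.
move=> g alpha a01; have [s [Ss sB sC1]] := h1 g _ a01; exists s; split=> //.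
rewrite -mulrA; apply: le_trans (ler_wpM2l (sqr_ge0 _) sC1).
rewrite -exprMn lerXn2r ?nnegrE ?(mulr_ge0 (ltW M0)) ?(alpha_norm_ge0 hmu) //.
exact: (alpha_norm_le hmu a01 M0).
Qed.
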